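(* Let $(f,\alpha)$ and $(g,\beta)$ be coherent labelled coloured configurations. Then $$W_{f,\alpha}^{\varepsilon} *_Y W_{g,\beta}^{\varepsilon} = W_{f\sqcup\!\sqcup g, \, \alpha\cup\beta}^{\varepsilon}$$ for each $\varepsilon\in \mathbb{Z}$.
   Context: Colours are elements of the poset $\Gamma=\{0>1>2>\dotsb\}$. On coloured positive integers $\sigma^\gamma$ ($\sigma\in\{1,2,\dots\}$, $\gamma\in\Gamma$) use the colour order $\dotsb<1^1<2^1<\dotsb<1^0<2^0<\dotsb$, i.e. $\sigma_1^{\gamma_1}<\sigma_2^{\gamma_2}$ iff $\gamma_1=\gamma_2$ and $\sigma_1<\sigma_2$, or $\gamma_1>\gamma_2$ as integers. A coloured permutation is a string $\bm a=\sigma_1^{\gamma_1}\dotsb\sigma_n^{\gamma_n}$ with distinct positive integers $\sigma_i$ and arbitrary colours $\gamma_i$; $|\bm a|=n$, its set of symbols is $\{\sigma_1,\dots,\sigma_n\}$, its palette is $\{\gamma_1,\dots,\gamma_n\}$, and $\mathrm{Pal}^*(\bm a)$ is the palette minus $\{0\}$. Its descent set is $\mathrm{Des}(\bm a)=\{i\in[n-1]:\sigma_i^{\gamma_i}>\sigma_{i+1}^{\gamma_{i+1}}\}$ if $\gamma_1=0$, and this set together with $0$ otherwise; $\operatorname{des}(\bm a)=|\mathrm{Des}(\bm a)|$, $\operatorname{comaj}(\bm a)=\sum_{i\in\mathrm{Des}(\bm a)}(n-i)$. A coloured configuration is an element $f=\sum_{\bm a} f_{\bm a}\bm a$ of the free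 commutative monoid on coloured permutations (a finite multiset); $\mathrm{supp}(f)$, its symbols and $\mathrm{Pal}^*(f)$ are unions over the support. $f,g$ are disjoint if their symbol sets are disjoint. For disjoint $\bm a,\bm b$, $\bm a\sqcup\!\sqcup\bm b$ denotes the shuffle product, the sum of all shuffles of $\bm a$ and $\bm b$, extended bi-additively to disjoint configurations. Let $\mathbb U=\{\pm X^k:k\in\mathbb{Z}\}\subset\mathbb{Q}(X)^\times$. For $\alpha:\Gamma\to\mathbb U$, $\mathrm{supp}(\alpha)=\{c:\alpha(c)\neq1\}$ and $\alpha(\bm a)=\prod_i\alpha(\gamma_i)$. A labelled coloured configuration is a pair $(f,\alpha)$ with $\mathrm{supp}(\alpha)\subseteq \mathrm{Pal}^*(f)$. $(f,\alpha)$ and $(g,\beta)$ are coherent if $f,g$ are disjoint and $\alpha(c)=\beta(c)$ for all $c\in\mathrm{Pal}^*(f)\cap\mathrm{Pal}^*(g)$; then $\alpha\cup\beta$ equals $\alpha$ on $\mathrm{Pal}^*(f)$, $\beta$ on $\mathrm{Pal}^*(g)$, and $1$ elsewhere. For $\varepsilon\in\mathbb{Z}$, $$W_{f,\alpha}^{\varepsilon}(X,Y)=\sum_{\bm a\in\mathrm{supp}(f)} f_{\bm a}\frac{\alpha(\bm a)X^{\varepsilon\operatorname{comaj}(\bm a)}Y^{\operatorname{des}(\bm a)}}{(1-Y)(1-X^{\varepsilon}Y)\dotsb(1-X^{\varepsilon|\bm a|}Y)}\in\mathbb{Q}(X)[[Y]].$$ $*_Y$ is the Hadamard product in $Y$: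 $\sum a_kY^k *_Y\sum b_kY^k=\sum a_kb_kY^k$. *)

(* Defs.v *)
From HB Require Import structures.
From mathcomp Require Import all_boot all_order all_algebra.
From mathcomp Require Import finmap multiset.
From mathcomp Require Import boolp.

Set Implicit Arguments.
Unset Strict Implicit.
Unset Printing Implicit Defensive.

Import GRing.Theory.

Local Open Scope ring_scope.

Record fps (R : Type) := FPS { fps_coef : nat -> R }.

HB.instance Definition _ (R : Type) := gen_eqMixin (fps R).
HB.instance Definition _ (R : Type) := gen_choiceMixin (fps R).

Lemma fpsP (R : Type) (f g : fps R) :
  (forall n, fps_coef f n = fps_coef g n) -> f = g.
Proof. by case: f g => [f] [g] /= /funext ->. Qed.

Section FpsZmodule.
Variable R : zmodType.
Implicit Types f g h : fps R.

Definition fps_zero : fps R := FPS (fun=> 0).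
Definition fps_opp f := FPS (fun n => - fps_coef f n).
Definition fps_add f g := FPS (fun n => fps_coef f n + fps_coef g n).

Fact fps_addA : associative fps_add.
Proof. by move=> f g h; apply: fpsP => n; apply: addrA. Qed.
Fact fps_addC : commutative fps_add.
Proof. by move=> f g; apply: fpsP => n; apply: addrC. Qed.
Fact fps_add0 : left_id fps_zero fps_add.
Proof. by move=> f; apply: fpsP => n; apply: add0r. Qed.
Fact fps_addN : left_inverse fps_zero fps_opp fps_add.
Proof. by move=> f; apply: fpsP => n; apply: addNr. Qed.

HB.instance Definition _ :=
  GRing.isZmodule.Build (fps R) fps_addA fps_addC fps_add0 fps_addN.
End FpsZmodule.

Section FpsRing.
Variable R : comNzRingType.
Implicit Types f g h : fps R.

Definition fpsC (c : R) : fps R := FPS (fun n => if n == 0%N then c else 0).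
Definition fpsY : fps R := FPS (fun n => (n == 1%N)%:R).
Definition fps_mul f g : fps R :=
  FPS (fun n => \sum_(i < n.+1) fps_coef f i * fps_coef g (n - i)%N).

Definition fps_trunc N f : {poly R} := \poly_(i < N) fps_coef f i.

Lemma fps_truncM N f g n : (n < N)%N ->
  (fps_trunc N f * fps_trunc N g)`_n = fps_coef (fps_mul f g) n.
Proof.
move=> nN; rewrite coefM; apply: eq_bigr => i _; rewrite !coef_poly.
by rewrite (leq_ltn_trans (leq_subr _ _) nN) (leq_trans (ltn_ord i) nN).
Qed.

Fact fps_mulC : commutative fps_mul.
Proof.
by move=> f g; apply: fpsP => n; rewrite -!(@fps_truncM n.+1) // mulrC.
Qed.

Fact fps_mulA : associative fps_mul.
Proof.
move=> f g h; apply: fpsP => n.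
transitivity ((fps_trunc n.+1 f * (fps_trunc n.+1 g * fps_trunc n.+1 h))`_n).
  rewrite coefM; apply: eq_bigr => i _.
  by rewrite fps_truncM ?ltnS ?leq_subr // coef_poly ltn_ord.
rewrite mulrA coefM; apply: eq_bigr => i _.
by rewrite fps_truncM // coef_poly ltnS leq_subr.
Qed.

Fact fps_mul1 : left_id (fpsC 1) fps_mul.
Proof.
move=> f; apply: fpsP => n; rewrite /= big_ord_recl /= mul1r subn0.
by rewrite big1 ?addr0 // => i _; rewrite /= mul0r.
Qed.

Fact fps_mulDl : left_distributive fps_mul +%R.
Proof.
move=> f g h; apply: fpsP => n; rewrite /= -big_split /=.
by apply: eq_bigr => i _; rewrite mulrDl.
Qed.

Fact fps_1neq0 : fpsC 1 != 0.
Proof.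
by apply/eqP => /(congr1 (fun f => fps_coef f 0)) /= /eqP; rewrite oner_eq0.
Qed.

HB.instance Definition _ := GRing.Zmodule_isComNzRing.Build (fps R)
  fps_mulA fps_mulC fps_mul1 fps_mulDl fps_1neq0.

Lemma fps_coefM f g n :
  fps_coef (f * g) n = \sum_(i < n.+1) fps_coef f i * fps_coef g (n - i)%N.
Proof. by []. Qed.

Definition fps_hadamard f g : fps R :=
  FPS (fun n => fps_coef f n * fps_coef g n).
End FpsRing.

Arguments fpsY {R}.
Notation "f *_Y g" := (fps_hadamard f g) (at level 40, left associativity)
  : ring_scope.

Section FpsUnitRing.
Variable R : comUnitRingType.
Implicit Types f g : fps R.

Definition fps_unit : {pred fps R} := fun f => fps_coef f 0 \is a GRing.unit.

(* The coefficients up to [n] of the inverse [g] of [f], obtained by solving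
   [\sum_(i < n.+1) g_i * f_(n - i) = (n == 0)%:R] successively for [g_n]. *)
Fixpoint fps_inv_seq f n : seq R :=
  if n is m.+1 then
    let s := fps_inv_seq f m in
    rcons s (- (\sum_(i < m.+1) s`_i * fps_coef f (m.+1 - i)%N)
             / fps_coef f 0)
  else [:: (fps_coef f 0)^-1].

Definition fps_inv f : fps R :=
  if fps_unit f then FPS (fun n => (fps_inv_seq f n)`_n) else f.

Lemma size_fps_inv_seq f n : size (fps_inv_seq f n) = n.+1.
Proof. by elim: n => //= n IHn; rewrite size_rcons IHn. Qed.

Lemma nth_fps_inv_seq f n i : (i <= n)%N ->
  (fps_inv_seq f n)`_i = (fps_inv_seq f i)`_i.
Proof.
elim: n => [|n IHn]; first by case: i.
rewrite leq_eqVlt => /orP[/eqP -> // | lt_in].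
by rewrite /= nth_rcons size_fps_inv_seq lt_in IHn.
Qed.

Fact fps_mulVf : {in fps_unit, left_inverse 1 fps_inv *%R}.
Proof.
move=> f uf; apply: fpsP => n; rewrite fps_coefM /fps_inv.
have uf0 : fps_coef f 0 \is a GRing.unit by [].
rewrite ifT //; case: n => [|n]; first by rewrite big_ord1 /= mulVr.
rewrite big_ord_recr /= subnn nth_rcons size_fps_inv_seq ltnn eqxx mulrVK //.
apply/eqP; rewrite subr_eq0; apply/eqP; apply: eq_bigr => i _.
by rewrite [in RHS]nth_fps_inv_seq // -ltnS.
Qed.

Fact fps_unitPl f g : g * f = 1 -> fps_unit f.
Proof.
move=> /(congr1 (fun f => fps_coef f 0)); rewrite fps_coefM big_ord1 /= => gf1.
by apply/unitrPr; exists (fps_coef g 0); rewrite mulrC.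
Qed.

Fact fps_inv_out : {in [predC fps_unit], fps_inv =1 id}.
Proof. by move=> f /negbTE nuf; rewrite /fps_inv ifF. Qed.

HB.instance Definition _ := GRing.ComNzRing_hasMulInverse.Build (fps R)
  fps_mulVf fps_unitPl fps_inv_out.

Lemma fps_unitE f :
  (f \is a GRing.unit) = (fps_coef f 0 \is a GRing.unit).
Proof. by []. Qed.

Lemma fps_unit1subCY (c : R) : 1 - fpsC c * fpsY \is a GRing.unit.
Proof.
by rewrite fps_unitE /= big_ord1 /= mulr0 subr0 unitr1.
Qed.
End FpsUnitRing.

(* The coloured integer [sigma^gamma] is the pair [(sigma, gamma)]. *)
Definition cint := (nat * nat)%type.

(* Colours are ordered by [0 > 1 > 2 > ...]. *)
Definition clt (x y : cint) : bool :=
  ((x.2 == y.2) && (x.1 < y.1)%N) || (y.2 < x.2)%N.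

Definition is_cperm (s : seq cint) : bool :=
  uniq [seq x.1 | x <- s] && all (fun x => 0 < x.1)%N s.

Record cperm := CPerm { cpseq :> seq cint; _ : is_cperm cpseq }.
HB.instance Definition _ := [isSub for cpseq].
HB.instance Definition _ := [Choice of cperm by <:].

Definition cp_symbols (a : cperm) : {fset nat} := [fset x.1 | x in cpseq a]%fset.
Definition cp_pal (a : cperm) : {fset nat} := [fset x.2 | x in cpseq a]%fset.
Definition cp_pal' (a : cperm) : {fset nat} := (cp_pal a `\ 0%N)%fset.

(* [nth] counts from [0], so the [i]-th and [i+1]-st symbols of the string are
   [nth _ a i.-1] and [nth _ a i]. The empty string has no descents. *)
Definition Des (a : cperm) : {set 'I_(size a)} :=
  [set i : 'I_(size a) |
    if i == 0%N :> nat then (nth (0, 0)%N a 0).2 != 0%N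
    else clt (nth (0, 0)%N a i) (nth (0, 0)%N a i.-1)].
Definition des (a : cperm) : nat := #|Des a|.
Definition comaj (a : cperm) : nat := (\sum_(i in Des a) (size a - i))%N.

Notation config := {mset cperm}%mset.

Definition cf_symbols (f : config) : {fset nat} :=
  (\bigcup_(a <- finsupp f) cp_symbols a)%fset.
Definition cf_pal' (f : config) : {fset nat} :=
  (\bigcup_(a <- finsupp f) cp_pal' a)%fset.

Definition cf_disjoint (f g : config) : bool :=
  [disjoint cf_symbols f & cf_symbols g]%fset.

Fixpoint shuffles (T : Type) (s : seq T) : seq T -> seq (seq T) :=
  fix shuffles_s (t : seq T) : seq (seq T) :=
    match s, t with
    | [::], _ => [:: t]
    | _, [::] => [:: s]
    | x :: s', y :: t' =>
        [seq x :: u | u <- shuffles s' t] ++ [seq y :: u | u <- shuffles_s t']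
    end.

Lemma perm_shuffles (T : eqType) (s t u : seq T) :
  u \in shuffles s t -> perm_eq u (s ++ t).
Proof.
elim: s t u => [|x s IHs] t u /=; first by case: t => [|y t]; rewrite inE => /eqP ->.
elim: t u => [|y t IHt] u; first by rewrite inE cats0 => /eqP ->.
rewrite mem_cat => /orP[] /mapP[v vP ->]; first by rewrite perm_cons IHs.
by rewrite -[x :: _]/((x :: s) ++ _) perm_sym perm_catC /= perm_cons
           perm_catC perm_sym IHt.
Qed.

Lemma shuffles_cperm (a b : cperm) :
  [disjoint cp_symbols a & cp_symbols b]%fset ->
  all is_cperm (shuffles (cpseq a) (cpseq b)).
Proof.
move=> /fdisjointP dab; have /andP[ua pa] := valP a.
have /andP[ub pb] := valP b; apply/allP => u /perm_shuffles uab.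
rewrite /is_cperm (perm_uniq (perm_map _ uab)) (perm_all _ uab) all_cat.
rewrite map_cat cat_uniq ua ub /= pa pb !andbT; apply/hasPn => x xb.
apply/negP => xa; have /negP[] : x \notin cp_symbols b.
  by apply: dab; case/mapP: xa => y ya ->; apply/imfsetP; exists y.
by case/mapP: xb => y yb ->; apply/imfsetP; exists y.
Qed.

(* Shuffles that are not coloured permutations are discarded; by
   [shuffles_cperm] there are none when [a] and [b] are disjoint. *)
Definition cp_shuffle (a b : cperm) : config :=
  seq_mset (pmap insub (shuffles (cpseq a) (cpseq b))).

(* [a <- f] and [b <- g] repeat each element according to its multiplicity. *)
Definition shuffle (f g : config) : config :=
  (\big[msetD/mset0]_(a <- f) \big[msetD/mset0]_(b <- g) cp_shuffle a b)%mset.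

HB.instance Definition _ (K : choiceType) :=
  Monoid.isComLaw.Build {mset K}%mset mset0 msetD
    (@msetDA K) (@msetDC K) (@mset0D K).

Lemma perm_enum_msetD (K : choiceType) (A B : {mset K}%mset) :
  perm_eq (A `+` B)%mset (A ++ B).
Proof. by apply/allP => a _ /=; rewrite count_cat !count_mem_mset msetE2. Qed.

Lemma shuffleDl (f1 f2 g : config) :
  shuffle (f1 `+` f2)%mset g = (shuffle f1 g `+` shuffle f2 g)%mset.
Proof. by rewrite /shuffle (perm_big _ (perm_enum_msetD _ _)) big_cat. Qed.

Lemma shuffleDr (f g1 g2 : config) :
  shuffle f (g1 `+` g2)%mset = (shuffle f g1 `+` shuffle f g2)%mset.
Proof.
rewrite /shuffle -big_split /=; apply: eq_bigr => a _.
by rewrite (perm_big _ (perm_enum_msetD _ _)) big_cat.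
Qed.

Lemma shuffle11 (a b : cperm) :
  shuffle [mset a]%mset [mset b]%mset = cp_shuffle a b.
Proof. by rewrite /shuffle !enum_msetn !big_seq1. Qed.

Definition QX : fieldType := {fraction {poly rat}}.
Definition X : QX := FracField.tofrac ('X : {poly rat}).

Definition in_U (x : QX) : Prop := exists k : int, x = X ^ k \/ x = - X ^ k.

Definition labelling := nat -> QX.

Definition labelled (f : config) (alpha : labelling) : Prop :=
  (forall c, in_U (alpha c)) /\ (forall c, alpha c != 1 -> c \in cf_pal' f).

Definition coherent (f : config) (alpha : labelling)
    (g : config) (beta : labelling) : Prop :=
  cf_disjoint f g /\
  (forall c, c \in (cf_pal' f `&` cf_pal' g)%fset -> alpha c = beta c).

Definition lab_union (f : config) (alpha : labelling)
    (g : config) (beta : labelling) : labelling :=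
  fun c => if c \in cf_pal' f then alpha c
           else if c \in cf_pal' g then beta c else 1.

Definition lab_cperm (alpha : labelling) (a : cperm) : QX :=
  \prod_(x <- cpseq a) alpha x.2.

Definition W (eps : int) (f : config) (alpha : labelling) : fps QX :=
  \sum_(a <- finsupp f)
    (f a)%:R *
    (fpsC (lab_cperm alpha a * X ^ (eps * (comaj a)%:Z)) * fpsY ^+ des a
     / \prod_(i < (size a).+1) (1 - fpsC (X ^ (eps * (i : nat)%:Z)) * fpsY)).

(* Main.v *)
(** The coefficient of [Y^k] in the summand of a coloured permutation [a] of
    length [n] enumerates, by [q = X^eps], the labellings
    [0 = m_0 <= m_1 <= ... <= m_n <= k] of its letters that increase strictly
    at the descents of [a], descents being taken in the word [a] prefixed by
    the letter [0^0]. Cutting [a] into blocks of equal label exhibits this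
    coefficient as a convolution product, for deconcatenation, of functionals
    supported on increasing words. Such a functional is multiplicative for
    shuffles of disjoint words, because two increasing words without common
    letter have exactly one increasing shuffle; and a convolution of
    multiplicative functionals is multiplicative, because deconcatenation is
    a morphism for the shuffle product. Hence each coefficient of [Y^k] is
    multiplicative. *)
Require Import Defs.
From mathcomp Require Import all_boot all_order all_algebra.
From mathcomp Require Import finmap multiset.
From mathcomp Require Import zify ring.

Set Implicit Arguments.
Unset Strict Implicit.
Unset Printing Implicit Defensive.

Local Open Scope ring_scope.

Import GRing.Theory.

(** * Shuffles, deconcatenation and convolution *)

Section Shuffles.
Variables (T : eqType) (R : comNzRingType).
Implicit Types (s t u : seq T) (F G : seq T -> R).

Lemma shuffles_0s t : shuffles [::] t = [:: t].
Proof. by case: t. Qed.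

Lemma shuffles_s0 s : shuffles s [::] = [:: s].
Proof. by case: s. Qed.

Lemma shuffles_cons x s y t :
  shuffles (x :: s) (y :: t) =
  [seq x :: u | u <- shuffles s (y :: t)] ++
  [seq y :: u | u <- shuffles (x :: s) t].
Proof. by []. Qed.

Fixpoint splits s : seq (seq T * seq T) :=
  ([::], s) ::
  if s is x :: s' then [seq (x :: p.1, p.2) | p <- splits s'] else [::].

Lemma splits_cat s p : p \in splits s -> p.1 ++ p.2 = s.
Proof.
elim: s p => [|x s IHs] p /=; first by rewrite inE => /eqP ->.
by rewrite inE => /orP[/eqP -> //|/mapP[r /IHs <- ->]].
Qed.

Lemma big_splits_cons (H : seq T -> seq T -> R) x s :
  \sum_(p <- splits (x :: s)) H p.1 p.2 =
  H [::] (x :: s) + \sum_(p <- splits s) H (x :: p.1) p.2.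
Proof. by rewrite /= big_cons big_map. Qed.

Lemma big_shuffles_cons F x s y t :
  \sum_(u <- shuffles (x :: s) (y :: t)) F u =
  \sum_(u <- shuffles s (y :: t)) F (x :: u) +
  \sum_(u <- shuffles (x :: s) t) F (y :: u).
Proof. by rewrite shuffles_cons big_cat !big_map. Qed.

(** Cutting a shuffle of [s] and [t] cuts both words, and each piece is a shuffle of the matching
    pieces. [H] is arbitrary so that the induction can absorb the first letter of the prefix into
    it. *)
Lemma big_shuffles_splits (H : seq T -> seq T -> R) s t :
  \sum_(u <- shuffles s t) \sum_(p <- splits u) H p.1 p.2 =
  \sum_(p <- splits s) \sum_(r <- splits t)
    \sum_(u <- shuffles p.1 r.1) \sum_(v <- shuffles p.2 r.2) H u v.
Proof.
elim: s t H => [|x s IHs] t H.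
  rewrite shuffles_0s !big_seq1; apply: eq_bigr => p _.
  by rewrite !shuffles_0s !big_seq1.
elim: t H => [|y t IHt] H.
  rewrite shuffles_s0 big_seq1; apply: eq_bigr => p _.
  by rewrite !big_seq1 /= !shuffles_s0 !big_seq1.
rewrite big_shuffles_cons.
under eq_bigr do rewrite big_splits_cons.
under [X in _ + X]eq_bigr do rewrite big_splits_cons.
rewrite !big_split /= addrACA (IHs _ (fun a => H (x :: a)))
  (IHt (fun a => H (y :: a))) -(big_shuffles_cons (H [::])).
(* [K] is the share of one pair of cuts; the terms are matched by which of the prefixes [s1], [t1]
   are empty. *)
pose K (H' : seq T -> seq T -> R) (s1 s2 t1 t2 : seq T) :=
  \sum_(u <- shuffles s1 t1) \sum_(v <- shuffles s2 t2) H' u v.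
have K0s H' s2 t1 t2 : K H' [::] s2 t1 t2 = \sum_(v <- shuffles s2 t2) H' t1 v.
  by rewrite /K shuffles_0s big_seq1.
have Ks0 H' s1 s2 t2 : K H' s1 s2 [::] t2 = \sum_(v <- shuffles s2 t2) H' s1 v.
  by rewrite /K shuffles_s0 big_seq1.
have Kcons s1 s2 t1 t2 : K H (x :: s1) s2 (y :: t1) t2 =
    K (fun a => H (x :: a)) s1 s2 (y :: t1) t2 +
    K (fun a => H (y :: a)) (x :: s1) s2 t1 t2.
  by rewrite /K big_shuffles_cons.
rewrite -/(splits (x :: s)) -/(splits (y :: t)).
transitivity (K H [::] (x :: s) [::] (y :: t) +
  (\sum_(p <- splits s) \sum_(r <- splits (y :: t))
     K (fun a => H (x :: a)) p.1 p.2 r.1 r.2 +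
   \sum_(p <- splits (x :: s)) \sum_(r <- splits t)
     K (fun a => H (y :: a)) p.1 p.2 r.1 r.2)).
  by rewrite K0s.
rewrite [RHS](big_splits_cons
  (fun s1 s2 => \sum_(r <- splits (y :: t)) K H s1 s2 r.1 r.2)).
rewrite [X in _ + (_ + X)](big_splits_cons
  (fun s1 s2 => \sum_(r <- splits t) K (fun a => H (y :: a)) s1 s2 r.1 r.2)).
rewrite (big_splits_cons (fun t1 t2 => K H [::] (x :: s) t1 t2)) -addrA.
congr (_ + _); rewrite addrCA; congr (_ + _).
  by apply: eq_bigr => r _; rewrite !K0s.
rewrite -big_split /=; apply: eq_bigr => p _.
rewrite -/(splits (y :: t)).
rewrite (big_splits_cons (fun t1 t2 => K (fun a => H (x :: a)) p.1 p.2 t1 t2)).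
rewrite (big_splits_cons (fun t1 t2 => K H (x :: p.1) p.2 t1 t2)) !Ks0 -addrA.
by congr (_ + _); rewrite -big_split; apply: eq_bigr => r _; rewrite Kcons.
Qed.

Definition conv F G s := \sum_(p <- splits s) F p.1 * G p.2.

Lemma conv_cons F G x s :
  conv F G (x :: s) = F [::] * G (x :: s) + conv (F \o cons x) G s.
Proof. exact: (big_splits_cons (fun a b => F a * G b)). Qed.

Definition disj s t := forall x, x \in s -> x \notin t.

Definition shuffle_char F := forall s t, disj s t ->
  \sum_(u <- shuffles s t) F u = F s * F t.

Lemma shuffle_char_conv F G :
  shuffle_char F -> shuffle_char G -> shuffle_char (conv F G).
Proof.
move=> cF cG s t dst.
rewrite (big_shuffles_splits (fun a b => F a * G b)) big_distrl /=.
apply: eq_big_seq => p /splits_cat ps; rewrite big_distrr /=.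
apply: eq_big_seq => r /splits_cat rt.
have d1 : disj p.1 r.1.
  move=> x xp; have := dst x; rewrite -ps -rt !mem_cat xp => /(_ isT).
  by rewrite negb_or => /andP[].
have d2 : disj p.2 r.2.
  move=> x xp; have := dst x; rewrite -ps -rt !mem_cat xp orbT => /(_ isT).
  by rewrite negb_or => /andP[].
rewrite mulrACA -cF // -cG // big_distrl /=.
by apply: eq_bigr => u _; rewrite big_distrr.
Qed.

(** All shuffles of two words have the same length. The factor accounts for raising every label by
    one. *)
Lemma shuffle_char_grade (q : R) F :
  shuffle_char F -> shuffle_char (fun s => q ^+ size s * F s).
Proof.
move=> cF s t dst; rewrite mulrACA -exprD -cF // big_distrr /=.
apply: eq_big_seq => u /perm_shuffles /perm_size ->.
by rewrite size_cat.
Qed.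

Lemma shuffle_char_counit : shuffle_char (fun s => (s == [::])%:R).
Proof.
move=> [|x s] [|y t] _; rewrite ?shuffles_s0 ?big_seq1 ?mul1r ?mulr1 //.
by rewrite big_shuffles_cons !big1 ?addr0 ?mul0r.
Qed.
End Shuffles.

(** * Coefficients of power series *)

Section FpsCoef.
Variable R : comNzRingType.
Implicit Types (f : fps R) (a b : R).

Lemma fps_coefD f g n : fps_coef (f + g) n = fps_coef f n + fps_coef g n.
Proof. by []. Qed.

Lemma fps_coefB f g n : fps_coef (f - g) n = fps_coef f n - fps_coef g n.
Proof. by []. Qed.

Lemma fps_coef_sum (I : Type) (r : seq I) (F : I -> fps R) n :
  fps_coef (\sum_(i <- r) F i) n = \sum_(i <- r) fps_coef (F i) n.
Proof. by apply: (big_morph (fun f => fps_coef f n)) => // f g. Qed.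

Lemma fps_coefCM a f n : fps_coef (fpsC a * f) n = a * fps_coef f n.
Proof.
rewrite fps_coefM big_ord_recl /= subn0 big1 ?addr0 // => i _.
by rewrite mul0r.
Qed.

Lemma fps_coefYM f n :
  fps_coef (fpsY * f) n = if n is m.+1 then fps_coef f m else 0.
Proof.
rewrite fps_coefM big_ord_recl /= mul0r add0r; case: n => [|n].
  by rewrite big_ord0.
rewrite big_ord_recl /= subSS subn0 mul1r big1 ?addr0 // => i _.
by rewrite mul0r.
Qed.

Lemma fpsCM a b : fpsC (a * b) = fpsC a * fpsC b.
Proof. by apply: fpsP => -[|n]; rewrite fps_coefCM //= mulr0. Qed.
End FpsCoef.

(** * Enumeration of labellings and its generating series *)

Section PPartitions.
Variables (T : eqType) (R : comNzRingType) (e : rel T) (w : T -> R) (q : R).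
Hypotheses (e_tr : transitive e)
  (e_tot : forall x y, x != y -> e y x = ~~ e x y).
Implicit Types (c : pred T) (s t : seq T) (k : nat).

(** The weight of letters sharing one label. [c] encodes the constraint from the preceding letter;
    for [c] closed upwards along [e], imposing it on all letters of a sorted word amounts to
    imposing it on the first. *)
Definition block c s : R :=
  (sorted e s && all c s)%:R * \prod_(x <- s) w x.

Lemma block0 c : block c [::] = 1.
Proof. by rewrite /block big_nil mulr1. Qed.

Lemma block_cons c x s : (forall x y, c x -> e x y -> c y) ->
  block c (x :: s) = (c x)%:R * (w x * block (e x) s).
Proof.
move=> c_up; rewrite /block big_cons /= path_sortedE //.
case cx: (c x); last by rewrite andbF !mul0r.
rewrite mul1r [RHS]mulrCA; congr (_%:R * _); rewrite /= andbC andbCA andbA.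
case ex: (all (e x) s); rewrite ?andbF //= andbT.
rewrite (_ : all c s) ?andbT //.
by apply: sub_all ex => y; apply: c_up.
Qed.

Lemma shuffle_char_block c : (forall x y, c x -> e x y -> c y) ->
  shuffle_char (block c).
Proof.
(* The induction keeps [c] general, since removing a head [x] replaces [c] by [e x]. *)
move=> c_up s t; have [n] := ubnP (size s + size t).
elim: n c c_up s t => // n IHn c c_up [|x s] [|y t] /= lt_n dst;
  rewrite ?big_seq1 ?block0 ?mul1r ?mulr1 //.
rewrite -/(shuffles (x :: s) (y :: t)) big_shuffles_cons.
have e_up z : forall x y, e z x -> e x y -> e z y by move=> ? ?; apply: e_tr.
under eq_bigr do rewrite block_cons //.
under [X in _ + X]eq_bigr do rewrite block_cons //.
rewrite -!mulr_sumr.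
have dst1 : disj s (y :: t) by move=> z zs; apply: dst; rewrite inE zs orbT.
have dst2 : disj (x :: s) t.
  by move=> z zs; have := dst z zs; rewrite inE negb_or => /andP[].
rewrite addnS in lt_n.
rewrite (IHn _ (e_up x)) ?(IHn _ (e_up y)) //=; last by rewrite addnS.
rewrite !block_cons //; try exact: e_up.
have /e_tot e_yx : x != y.
  by have := dst x; rewrite !inE eqxx negb_or => /(_ isT)/andP[].
have cyx : c x -> e x y -> c y by apply: c_up.
have cxy : c y -> e y x -> c x by apply: c_up.
move: cyx cxy; rewrite e_yx.
(* Up to common factors the claim is [c x][e x y] + [c y][e y x] = [c x][c y]: exactly one of
   [e x y], [e y x] holds, and the smaller head forces [c] on the other. *)
case: (c x) (c y) (e x y) => [] [] [] /= cyx cxy; try ring.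
all: by [have := cyx isT isT | have := cxy isT isT].
Qed.

(* [ppart c k s] sums [\prod_i w s_i * q ^+ m_i] over the labellings
   [0 <= m_1 <= ... <= m_n <= k] of the letters of [s] such that
   [m_i < m_(i+1)] unless [e s_i s_(i+1)], and [0 < m_1] unless [c s_1];
   [ppos k s] is the part of this sum with [0 < m_1]. *)
Fixpoint ppos k s : R :=
  if k is k'.+1 then q ^+ size s * conv (block predT) (ppos k') s
  else (s == [::])%:R.

Definition ppart c k : seq T -> R := conv (block c) (ppos k).

Lemma shuffle_char_ppart c k : (forall x y, c x -> e x y -> c y) ->
  shuffle_char (ppart c k).
Proof.
move=> c_up; apply: shuffle_char_conv; first exact: shuffle_char_block.
elim: k => [|k IHk]; first exact: shuffle_char_counit.
by apply/shuffle_char_grade/shuffle_char_conv => //; apply: shuffle_char_block.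
Qed.

Lemma ppart0 c k : ppart c k [::] = 1.
Proof.
suff p0 : ppos k [::] = 1 by rewrite /ppart /conv big_seq1 block0 p0 mulr1.
by elim: k => //= k IHk; rewrite /conv big_seq1 block0 IHk !mulr1.
Qed.

(** Either the first label is positive, or it is zero; then [c x] must hold and [s] is labelled as a
    word preceded by [x]. *)
Lemma ppart_cons c k x s : (forall x y, c x -> e x y -> c y) ->
  ppart c k (x :: s) =
  ppos k (x :: s) + (c x)%:R * (w x * ppart (e x) k s).
Proof.
move=> c_up; rewrite /ppart conv_cons block0 mul1r; congr (_ + _).
rewrite /conv !mulr_sumr; apply: eq_bigr => p _ /=.
by rewrite block_cons // !mulrA.
Qed.

Fixpoint ndes x s : nat :=
  if s is y :: s' then (~~ e x y + ndes y s')%N else 0.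

Fixpoint ncomaj x s : nat :=
  if s is y :: s' then (~~ e x y * size s + ncomaj y s')%N else 0.

Lemma ppart_series x s :
  FPS (fun k => ppart (e x) k s) *
    \prod_(i < (size s).+1) (1 - fpsC (q ^+ i) * fpsY) =
  fpsC (\prod_(y <- s) w y * q ^+ ncomaj x s) * fpsY ^+ ndes x s.
Proof.
have e_up z : forall x y : T, e z x -> e x y -> e z y.
  by move=> ? ?; apply: e_tr.
elim: s x => [|y s IHs] x.
  rewrite big_ord1 /= big_nil !mulr1; apply: fpsP => n; rewrite mulrC.
  rewrite mulrBl mul1r -mulrA.
  rewrite fps_coefB fps_coefCM fps_coefYM mul1r.
  by case: n => [|n] /=; rewrite !ppart0 ?subr0 ?subrr.
set n := size (y :: s); set U := FPS (fun k => ppart predT k (y :: s)).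
(* [U] leaves [y] unconstrained. Labellings with positive first label are all labellings raised by
   one, whence [q ^+ n] and a shift in [k]; those with first label zero remain. *)
have U_rec : U * (1 - fpsC (q ^+ n) * fpsY) =
    fpsC (w y) * FPS (fun k => ppart (e y) k s).
  rewrite mulrBr mulr1; apply/eqP; rewrite subr_eq; apply/eqP/fpsP => k.
  rewrite [U * _]mulrC -mulrA fps_coefD !fps_coefCM fps_coefYM /= ppart_cons //.
  by rewrite mul1r addrC; case: k => [|k] /=; rewrite ?mulr0.
(* A descent from [x] to [y] forces a positive first label, hence the same shift of [U]. *)
have -> : FPS (fun k => ppart (e x) k (y :: s)) =
    fpsC (q ^+ (~~ e x y * n)) * fpsY ^+ (~~ e x y) * U.
  apply: fpsP => k; rewrite -mulrA fps_coefCM [LHS]/=.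
  rewrite (ppart_cons _ _ _ (e_up x)).
  case: (e x y); rewrite [nat_of_bool _]/=.
    by rewrite mul0n !mul1r [RHS]/= ppart_cons // mul1r.
  rewrite mul0r addr0 mul1n fps_coefYM.
  by case: k => [|k] //; rewrite mulr0.
rewrite big_ord_recr [X in _ * X = _]mulrC mulrA -[X in X * _ = _]mulrA U_rec.
rewrite -!mulrA IHs big_cons /= !exprD !fpsCM; ring.
Qed.
End PPartitions.

(** * The colour order and the descent statistics *)

Definition cle (x y : cint) : bool := ~~ clt y x.

Lemma cle_trans : transitive cle.
Proof.
move=> [y1 y2] [x1 x2] [z1 z2]; rewrite /cle /clt /=; lia.
Qed.

Lemma cle_total x y : x != y -> cle y x = ~~ cle x y.
Proof.
move: x y => [x1 x2] [y1 y2]; rewrite /cle /clt xpair_eqE /=; lia.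
Qed.

Definition cpart (alpha : labelling) (q : QX) (k : nat) : seq cint -> QX :=
  ppart cle (fun x => alpha x.2) q (cle (0, 0)%N) k.

Lemma clt_nth_ndes p s :
  (\sum_(i < size s) clt (nth (0, 0) s i) (nth (0, 0) (p :: s) i))%N
  = ndes cle p s.
Proof.
elim: s p => [|x s IHs] p; first by rewrite big_ord0.
by rewrite big_ord_recl /= /cle negbK -IHs.
Qed.

Lemma clt_nth_ncomaj p s :
  (\sum_(i < size s)
     clt (nth (0, 0) s i) (nth (0, 0) (p :: s) i) * (size s - i))%N
  = ncomaj cle p s.
Proof.
elim: s p => [|x s IHs] p; first by rewrite big_ord0.
by rewrite big_ord_recl /= /cle negbK -IHs.
Qed.

(* The convention [0 \in Des a] iff the first colour is nonzero amounts to a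
   descent from the fictitious letter [0^0] prefixed to [a]. *)
Lemma in_Des (a : cperm) i :
  (i \in Des a) = clt (nth (0, 0)%N a i) (nth (0, 0)%N ((0, 0)%N :: a) i).
Proof.
rewrite inE; case: i => -[|i] //= lt_i.
by rewrite /clt ltn0 andbF lt0n.
Qed.

Lemma des_ndes (a : cperm) : des a = ndes cle (0, 0)%N a.
Proof.
rewrite /des -sum1_card big_mkcond /= -clt_nth_ndes; apply: eq_bigr => i _.
by rewrite in_Des; case: clt.
Qed.

Lemma comaj_ncomaj (a : cperm) : comaj a = ncomaj cle (0, 0)%N a.
Proof.
rewrite /comaj big_mkcond /= -clt_nth_ncomaj; apply: eq_bigr => i _.
by rewrite in_Des; case: clt; rewrite ?mul1n ?mul0n.
Qed.

(** * Coefficients of [W] and sums over shuffles *)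

Lemma big_mset_finsupp (f : config) (F : cperm -> QX) :
  \sum_(a <- finsupp f) (f a)%:R * F a = \sum_(a <- f) F a.
Proof. by rewrite [RHS]big_mset; apply: eq_bigr => a _; rewrite mulr_natl. Qed.

Lemma eq_W eps f (alpha beta : labelling) :
  (forall a, a \in f -> {in cpseq a, forall x, alpha x.2 = beta x.2}) ->
  W eps f alpha = W eps f beta.
Proof.
move=> eq_ab; apply: eq_big_seq => a; rewrite msuppE => /eq_ab eq_a.
by rewrite /lab_cperm (eq_big_seq _ eq_a).
Qed.

Lemma coef_W eps f alpha k :
  fps_coef (W eps f alpha) k = \sum_(a <- f) cpart alpha (X ^ eps) k a.
Proof.
rewrite -big_mset_finsupp fps_coef_sum; apply: eq_bigr => a _.
rewrite !mulr_natl; set t := (X in X *+ _).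
suff -> : t = FPS (fun k => cpart alpha (X ^ eps) k a).
  by elim: (f a) => // n IHn; rewrite !mulrS fps_coefD IHn.
have Xeps m : X ^ (eps * m%:Z) = (X ^ eps) ^+ m by rewrite exprnP exprz_exp.
have unit_den : \prod_(i < (size a).+1) (1 - fpsC ((X ^ eps) ^+ i) * fpsY)
    \is a GRing.unit.
  by apply: rpred_prod => i _; apply: fps_unit1subCY.
(* The denominator is a unit, so the summand is compared with the series after clearing it. *)
apply: (mulIr unit_den); rewrite ppart_series; last exact: cle_trans.
rewrite -des_ndes -comaj_ncomaj /t Xeps.
have -> : \prod_(i < (size a).+1) (1 - fpsC (X ^ (eps * i%:Z)) * fpsY) =
    \prod_(i < (size a).+1) (1 - fpsC ((X ^ eps) ^+ i) * fpsY).
  by apply: eq_bigr => i _; rewrite Xeps.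
by rewrite mulrVK.
Qed.

Lemma big_shuffle (f g : config) (F : cperm -> QX) :
  \sum_(c <- shuffle f g) F c =
  \sum_(a <- f) \sum_(b <- g) \sum_(c <- cp_shuffle a b) F c.
Proof.
have sum0 : \sum_(c <- (mset0 : config)) F c = 0 by rewrite enum_mset0 big_nil.
have sumD (A B : config) : \sum_(c <- (A `+` B)%mset) F c =
    \sum_(c <- A) F c + \sum_(c <- B) F c.
  by rewrite (perm_big _ (perm_enum_msetD _ _)) big_cat.
pose S (A : config) := \sum_(c <- A) F c.
rewrite -/(S _) (big_morph S sumD sum0); apply: eq_bigr => a _.
exact: (big_morph S sumD sum0).
Qed.

(** For disjoint [a] and [b], [insub] discards no shuffle. *)
Lemma big_cp_shuffle (a b : cperm) (F : seq cint -> QX) :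
  [disjoint cp_symbols a & cp_symbols b]%fset ->
  \sum_(c <- cp_shuffle a b) F c = \sum_(u <- shuffles a b) F u.
Proof.
move=> /shuffles_cperm/allP cperm_u.
rewrite (perm_big _ (perm_eq_seq_mset _)) big_pmap.
apply: eq_big_seq => u /cperm_u u_cperm.
by rewrite (insubT is_cperm u_cperm).
Qed.

Lemma cp_pal'_cf_pal' (f : config) (a : cperm) c :
  a \in f -> c \in cp_pal a -> c != 0%N -> c \in cf_pal' f.
Proof.
move=> af ca c0; apply/bigfcupP; exists a; first by rewrite msuppE af.
by rewrite !inE c0.
Qed.

Theorem theorem2p2 (f g : config) (alpha beta : labelling)
    (f_alpha : labelled f alpha) (g_beta : labelled g beta)
    (coh : coherent f alpha g beta) (eps : int) :
  W eps f alpha *_Y W eps g beta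
  = W eps (shuffle f g) (lab_union f alpha g beta).
Proof.
case: coh => dfg ab_eq; have [_ f_supp] := f_alpha.
have [_ g_supp] := g_beta; set gamma := lab_union _ _ _ _.
(* Colour 0 never lies in [cf_pal' f], which contains the support of [alpha]. *)
have alpha0 : alpha 0%N = 1.
  by apply/eqP; apply: contraT => /f_supp /bigfcupP[a _]; rewrite !inE.
have beta0 : beta 0%N = 1.
  by apply/eqP; apply: contraT => /g_supp /bigfcupP[a _]; rewrite !inE.
have gamma0 : gamma 0%N = 1.
  by rewrite /gamma /lab_union alpha0 beta0; do !case: ifP.
have alphaE a : a \in f -> {in cpseq a, forall x, alpha x.2 = gamma x.2}.
  move=> af x xa; have [-> | x0] := eqVneq x.2 0%N; first by rewrite alpha0.
  rewrite /gamma /lab_union (cp_pal'_cf_pal' af) //.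
  by apply/imfsetP; exists x.
have betaE b : b \in g -> {in cpseq b, forall x, beta x.2 = gamma x.2}.
  move=> bg x xb; have [-> | x0] := eqVneq x.2 0%N; first by rewrite beta0.
  have xg : x.2 \in cf_pal' g.
    by apply: (cp_pal'_cf_pal' bg) => //; apply/imfsetP; exists x.
  rewrite /gamma /lab_union xg; case: ifP => // xf.
  by rewrite ab_eq // inE xf xg.
(* With the common labelling [gamma], both sides involve the single functional [cpart gamma], and
   the claim reduces to its multiplicativity on each pair [a], [b]. *)
rewrite (eq_W _ alphaE) (eq_W _ betaE).
apply: fpsP => k; rewrite /= !coef_W big_shuffle big_distrl /=.
apply: eq_big_seq => a af; rewrite big_distrr /=; apply: eq_big_seq => b bg.
have dab : [disjoint cp_symbols a & cp_symbols b]%fset.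
  have sub_symbols (h : config) c : c \in h ->
      (cp_symbols c `<=` cf_symbols h)%fset.
    by move=> ch; apply: bigfcup_sup => //; rewrite msuppE.
  apply: fdisjointWl (sub_symbols _ _ af) _.
  exact: fdisjointWr (sub_symbols _ _ bg) dfg.
rewrite (big_cp_shuffle _ dab).
symmetry; apply: shuffle_char_ppart.
- exact: cle_trans.
- exact: cle_total.
- by move=> x y; apply: cle_trans.
move=> x xa; apply/negP => xb.
have /negP[] : x.1 \notin cp_symbols b.
  by apply: (fdisjointP dab); apply/imfsetP; exists x.
by apply/imfsetP; exists x.
Qed.
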